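(* Let $n\ge 2$, let $a\in\mathbb{B}^n$, and let $f:\mathbb{B}^n\setminus\{0\}\to\mathbb{B}^n\setminus\{a\}$ be a Möbius map (of $\mathbb{B}^n\setminus\{0\}$ onto $\mathbb{B}^n\setminus\{a\}$) with $f(0)=a$. Then for all $x,y\in\mathbb{B}^n\setminus\{0\}$, $$\frac{1-|a|}{1+|a|}\,c_{\mathbb{B}^n\setminus\{0\}}(x,y)\le c_{\mathbb{B}^n\setminus\{a\}}(f(x),f(y))\le \frac{1+|a|}{1-|a|}\,c_{\mathbb{B}^n\setminus\{0\}}(x,y).$$ The equalities in both sides can be attained: for every $a\in\mathbb{B}^n$ there are such an $f$ and distinct points $x,y\in\mathbb{B}^n\setminus\{0\}$ for which equality holds in the left inequality, and such an $f$ and distinct points $x,y\in\mathbb{B}^n\setminus\{0\}$ for which equality holds in the right inequality.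
   Context: $\mathbb{B}^n=\{x\in\mathbb{R}^n:|x|<1\}$ is the Euclidean unit ball. For a domain $D\subsetneq\mathbb{R}^n$, the Cassinian metric on $D$ is $$c_D(x,y)=\sup_{p\in\partial D}\frac{|x-y|}{|x-p||p-y|},\qquad x,y\in D,$$ where $|\cdot|$ is the Euclidean norm. Thus $\partial(\mathbb{B}^n\setminus\{a\})=\partial\mathbb{B}^n\cup\{a\}$. A Möbius map is the restriction of a Möbius transformation of $\overline{\mathbb{R}^n}=\mathbb{R}^n\cup\{\infty\}$ (a finite composition of inversions in spheres and reflections in hyperplanes); $f(0)=a$ refers to this Möbius transformation, which maps $\mathbb{B}^n$ onto $\mathbb{B}^n$. *)

(* Defs.v *)
From HB Require Import structures.
From mathcomp Require Import all_boot all_order all_algebra.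
From mathcomp Require Import all_classical all_reals all_analysis.
Set Implicit Arguments.
Unset Strict Implicit.
Unset Printing Implicit Defensive.
Import Order.TTheory GRing.Theory Num.Theory.
Import numFieldNormedType.Exports.
Local Open Scope classical_set_scope.
Local Open Scope ring_scope.

Definition edot (R : realType) (n : nat) (u v : 'rV[R]_n) : R :=
  \sum_(i < n) u 0 i * v 0 i.

(* The library norm `|x| on 'rV[R]_n is the sup norm, hence a separate
   Euclidean norm; the two induce the same topology. *)
Definition enorm (R : realType) (n : nat) (x : 'rV[R]_n) : R :=
  Num.sqrt (edot x x).

Definition unit_ball (R : realType) (n : nat) : set 'rV[R]_n :=
  [set x | enorm x < 1].
Arguments unit_ball : clear implicits.

Definition boundary (T : topologicalType) (D : set T) : set T :=
  closure D `\` interior D.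

(* When D is a domain other than the whole space and x, y are in D, the set
   below is nonempty and bounded above, so that the real supremum is genuine. *)
Definition cassinian (R : realType) (n : nat) (D : set 'rV[R]_n)
    (x y : 'rV[R]_n) : R :=
  sup [set enorm (x - y) / (enorm (x - p) * enorm (p - y)) |
        p in (boundary D : set 'rV[R]_n)].

Definition inversion (R : realType) (n : nat) (c : 'rV[R]_n) (r : R)
    (z : one_point_compactification 'rV[R]_n) :
    one_point_compactification 'rV[R]_n :=
  match z with
  | Some x => if x == c then None
              else Some (c + (r ^+ 2 / enorm (x - c) ^+ 2) *: (x - c))
  | None => Some c
  end.

(* Reflection in the hyperplane {x | edot x u = t}. *)
Definition reflection (R : realType) (n : nat) (u : 'rV[R]_n) (t : R)
    (z : one_point_compactification 'rV[R]_n) :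
    one_point_compactification 'rV[R]_n :=
  match z with
  | Some x => Some (x - (2 * (edot x u - t) / enorm u ^+ 2) *: u)
  | None => None
  end.

Inductive mobius_transformation (R : realType) (n : nat) :
    (one_point_compactification 'rV[R]_n ->
     one_point_compactification 'rV[R]_n) -> Prop :=
| mobius_inversion (c : 'rV[R]_n) (r : R) :
    0 < r -> mobius_transformation (inversion c r)
| mobius_reflection (u : 'rV[R]_n) (t : R) :
    u != 0 -> mobius_transformation (reflection u t)
| mobius_comp F G :
    mobius_transformation F -> mobius_transformation G ->
    mobius_transformation (F \o G).

(* Only the values of f on the punctured ball matter. The value at the
   puncture 0 is the one taken by the Moebius transformation F extending f. *)
Definition punctured_ball_mobius (R : realType) (n : nat) (a : 'rV[R]_n)
    (f : 'rV[R]_n -> 'rV[R]_n) : Prop :=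
  exists F : one_point_compactification 'rV[R]_n ->
             one_point_compactification 'rV[R]_n,
    [/\ mobius_transformation F,
        forall x, (unit_ball R n `\ 0) x -> F (Some x) = Some (f x),
        f @` (unit_ball R n `\ 0) = unit_ball R n `\ a
      & F (Some 0) = Some a].

(* Main.v *)
Require Import Defs.
From HB Require Import structures.
From mathcomp Require Import all_boot all_order all_algebra.
From mathcomp Require Import all_classical all_reals all_analysis.
From mathcomp Require Import ring lra.
Set Implicit Arguments.
Unset Strict Implicit.
Unset Printing Implicit Defensive.
Import Order.TTheory GRing.Theory Num.Theory.
Import numFieldNormedType.Exports.
Local Open Scope classical_set_scope.
Local Open Scope ring_scope.

(** A Moebius transformation multiplies distances in the following sense:
there is a positive function [k] on the whole compactification, the conformal
factor, with [|F x - F y|^2 = k x * k y * |x - y|^2].  So the expression under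
the supremum of the Cassinian metric transforms by one single factor,
[ratio x y p = k p * ratio (F x) (F y) (F p)]
([cassinian_ratio_conformal]): the factors of [x] and [y] cancel, and only that
of the boundary point [p] is left.  The theorem is therefore a matter of
bounding [k] on the boundary of the punctured ball, which is the unit sphere
together with the puncture.

As [F] maps the ball onto itself, it maps the sphere onto itself
([sphere_image]).  For [p] on the sphere, the scaling rule applied to [p] and
[0] reads [k p * k 0 = |F p - a|^2] ([conformal_center]), a number between
[(1 - |a|)^2] and [(1 + |a|)^2].  Moreover [k 0 = 1 - |a|^2]
([center_factor]).  Hence [k p] lies between [(1 - |a|) / (1 + |a|)] and
[(1 + |a|) / (1 - |a|)], and so does [k 0] itself
([boundary_factor_bounds]).  This proves one inequality for [F] and, applied
to the inverse of [F], the other one.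

Both inequalities are sharp for every [F].  The extreme values of [k] are taken
at the points [p] of the sphere with [F p = - a / |a|] (the largest) and
[F p = a / |a|] (the smallest), where [a / |a|] is any unit vector if [a = 0].
When two points lie on the radius ending at
a point of the sphere, at distance at least 1/2 from the origin, the supremum
is attained at that endpoint ([cassinian_radial]).  For the upper bound such a
pair is taken in the source, on the radius of the second [p]; for the lower
bound it is taken in the target, on the radius of [- a / |a|].  Finally a
Moebius map of the required kind exists: the inversion preserving the ball and
exchanging [0] and [a], or a reflection in a hyperplane through the origin
when [a = 0] ([exists_punctured_ball_mobius]). *)

(** * Euclidean inner product and norm *)

Section Euclid.
Context {R : realType} {n : nat}.
Implicit Types (u v w x y p q : 'rV[R]_n) (s t : R).

Lemma edotC u v : edot u v = edot v u.
Proof. by apply: eq_bigr => i _; rewrite mulrC. Qed.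

Lemma edotDl u v w : edot (u + v) w = edot u w + edot v w.
Proof. by rewrite -big_split; apply: eq_bigr => i _; rewrite mxE mulrDl. Qed.

Lemma edotZl t u v : edot (t *: u) v = t * edot u v.
Proof. by rewrite big_distrr; apply: eq_bigr => i _; rewrite mxE /= mulrA. Qed.

Lemma edotNl u v : edot (- u) v = - edot u v.
Proof. by rewrite -scaleN1r edotZl mulN1r. Qed.

Lemma edotDr u v w : edot w (u + v) = edot w u + edot w v.
Proof. by rewrite ![edot w _]edotC edotDl. Qed.

Lemma edotZr t u v : edot u (t *: v) = t * edot u v.
Proof. by rewrite ![edot u _]edotC edotZl. Qed.

Lemma edotNr u v : edot u (- v) = - edot u v.
Proof. by rewrite ![edot u _]edotC edotNl. Qed.

Definition edotE := (edotDl, edotDr, edotNl, edotNr, edotZl, edotZr).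

Lemma edot0l u : edot 0 u = 0.
Proof. by rewrite -(scale0r 0) edotZl mul0r. Qed.

Lemma edot_ge0 u : 0 <= edot u u.
Proof. by apply: sumr_ge0 => i _; rewrite -expr2 sqr_ge0. Qed.

Lemma edot_eq0 u : (edot u u == 0) = (u == 0).
Proof.
apply/eqP/eqP => [h|->]; last by rewrite edot0l.
apply/rowP => i; rewrite mxE; apply/eqP.
have /eqP := @psumr_eq0P _ _ _ (fun i => u 0 i * u 0 i)
  (fun i _ => sqr_ge0 (u 0 i)) h i isT.
by rewrite mulf_eq0 orbb.
Qed.

Lemma edot_gt0 u : (0 < edot u u) = (u != 0).
Proof. by rewrite lt0r edot_ge0 andbT edot_eq0. Qed.

Lemma cauchy_schwarz u v : edot u v ^+ 2 <= edot u u * edot v v.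
Proof.
have [->|v0] := eqVneq v 0; first by rewrite edotC !edot0l expr0n mulr0.
rewrite -edot_gt0 in v0.
have := edot_ge0 (edot v v *: u - edot u v *: v).
rewrite !edotE [edot v u]edotC => h.
rewrite -subr_ge0 -(pmulr_rge0 _ v0); apply: le_trans h _.
by rewrite le_eqVlt; apply/orP; left; apply/eqP; ring.
Qed.

Lemma enorm_ge0 u : 0 <= enorm u.
Proof. exact: sqrtr_ge0. Qed.

Lemma sqr_enorm u : enorm u ^+ 2 = edot u u.
Proof. by rewrite sqr_sqrtr// edot_ge0. Qed.

Lemma enorm_gt0 u : (0 < enorm u) = (u != 0).
Proof. by rewrite sqrtr_gt0 edot_gt0. Qed.

Lemma enormN u : enorm (- u) = enorm u.
Proof. by rewrite /enorm edotNl edotNr opprK. Qed.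

Lemma enormB u v : enorm (u - v) = enorm (v - u).
Proof. by rewrite -enormN opprB. Qed.

Lemma enormZ t u : enorm (t *: u) = `|t| * enorm u.
Proof.
by rewrite /enorm edotZl edotZr mulrA -expr2 sqrtrM ?sqr_ge0// sqrtr_sqr.
Qed.

Lemma edot_le u v : `|edot u v| <= enorm u * enorm v.
Proof.
rewrite -ler_sqr ?nnegrE ?mulr_ge0 ?enorm_ge0//.
by rewrite exprMn !sqr_enorm real_normK ?num_real// cauchy_schwarz.
Qed.

Lemma enormD u v : enorm (u + v) <= enorm u + enorm v.
Proof.
rewrite -ler_sqr ?nnegrE ?addr_ge0 ?enorm_ge0//.
rewrite sqrrD !sqr_enorm !edotE [edot v u]edotC.
have := le_trans (ler_norm _) (edot_le u v); lra.
Qed.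

Lemma enorm_eq1 u : enorm u = 1 <-> edot u u = 1.
Proof.
rewrite -sqr_enorm; split => [->|/eqP]; first by rewrite expr1n.
by rewrite sqrp_eq1 ?enorm_ge0// => /eqP.
Qed.

Lemma enorm_lt1 u : (enorm u < 1) = (edot u u < 1).
Proof.
rewrite -sqr_enorm -[X in _ = (_ < X)](expr1n _ 2).
by rewrite ltr_sqr ?nnegrE ?enorm_ge0.
Qed.

Lemma unit_ball0 : unit_ball R n 0.
Proof. by rewrite /unit_ball/= enorm_lt1 edot0l. Qed.

(** For [u = 0] any unit vector will do; the arguments below then cover a centre
[a = 0] uniformly. *)
Lemma unit_direction (hn : (0 < n)%N) u :
  exists2 e : 'rV[R]_n, enorm e = 1 & u = enorm u *: e.
Proof.
have [->|u0] := eqVneq u 0.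
  exists (delta_mx 0 (Ordinal hn)); last by rewrite /enorm edot0l sqrtr0 scale0r.
  apply/enorm_eq1; rewrite /edot (bigD1 (Ordinal hn))//= big1 ?addr0 => [|i ni].
    by rewrite !mxE !eqxx mulr1.
  by rewrite !mxE (negbTE ni) andbF mulr0.
have h : enorm u != 0 by rewrite gt_eqF// enorm_gt0.
exists ((enorm u)^-1 *: u); last by rewrite scalerA divff// scale1r.
by rewrite enormZ ger0_norm ?invr_ge0 ?enorm_ge0// mulVf.
Qed.

Lemma enorm_continuous : continuous (@enorm R n).
Proof.
move=> x; apply: continuous_comp; last exact: sqrt_continuous.
suff : continuous (fun y : 'rV[R]_n => edot y y) by exact.
apply: continuous_big => [|i _ y]; first exact: add_continuous.
have c : continuous (fun y : 'rV[R]_n => y 0 i) by exact: coord_continuous.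
exact: (continuousM (c y) (c y)).
Qed.

End Euclid.

(** * Boundary of the punctured ball *)

Section PuncturedBall.
Context {R : realType} {n : nat}.
Implicit Types (a e p q u v x y : 'rV[R]_n) (s t : R).

(** The boundary points of the punctured ball are reached along straight
segments inside it. *)
Lemma closure_ray (D : set 'rV[R]_n) p u t0 : 0 < t0 ->
  (forall t, 0 < t < t0 -> D (p + t *: u)) -> closure D p.
Proof.
move=> t0_gt0 hD U Up.
have pu : p + t *: u @[t --> 0^'+] --> p.
  have -> : nbhs p = nbhs (p + (0 : R) *: u) by rewrite scale0r addr0.
  apply: cvg_at_right_filter; apply: cvgD; first exact: cvg_cst.
  exact: scalel_continuous.
have near_D : \forall t \near 0^'+, D (p + t *: u).
  near=> t; apply: hD; apply/andP; split; near: t.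
    exact: nbhs_right_gt.
  exact: nbhs_right_lt.
have [t [Dt Ut]] := filter_ex (filterI near_D (pu _ Up)).
by exists (p + t *: u).
Unshelve. all: by end_near.
Qed.

Lemma open_punctured_ball a : open (unit_ball R n `\ a).
Proof.
have -> : unit_ball R n `\ a =
    @enorm R n @^-1` [set t | t < 1] `&`
    (fun x => enorm (x - a)) @^-1` [set t | t > 0].
  by apply/seteqP; split=> x /=; rewrite enorm_gt0 subr_eq0 => -[? /eqP].
apply: openI.
  by apply: open_comp; [move=> ? _; exact: enorm_continuous|exact: open_lt].
apply: open_comp; last exact: open_gt.
move=> x _; apply: continuous_comp; last exact: enorm_continuous.
by apply: continuousB => //; apply: cst_continuous.
Qed.

Lemma boundary_punctured_ball a p : (0 < n)%N -> unit_ball R n a ->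
  boundary (unit_ball R n `\ a) p <-> enorm p = 1 \/ p = a.
Proof.
rewrite /unit_ball/= => hn ha.
have a0 := enorm_ge0 a.
rewrite /boundary (interior_id _).1; last exact: open_punctured_ball.
split=> [[pD pND]|hp].
  have p1 : enorm p <= 1.
    have cB : closed (@enorm R n @^-1` [set t | t <= 1]).
      by apply: preimage_closed => [? _|]; [exact: enorm_continuous|exact: closed_le].
    have : closure (@enorm R n @^-1` [set t | t <= 1]) p.
      by apply: closureS pD => x [/ltW].
    by rewrite -((closure_id _).1 cB).
  have [->|/eqP pa] := eqVneq p a; [by right|left].
  apply/eqP; rewrite eq_le p1 leNgt /=; apply/negP => p_lt1.
  by apply: pND; split.
split; last by case: hp => [p1 [/=]|-> [_]]; [rewrite p1 ltxx|apply].
have ta : 0 < 1 - enorm a by rewrite subr_gt0.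
case: hp => [p1|->].
  (* As long as it is shorter than [1 - enorm a], an inward radial segment from [p]
     stays at norm larger than [enorm a], so it avoids [a]. *)
  apply: (closure_ray (u := - p) ta) => t /andP[t0 t1].
  have pt : enorm (p + t *: - p) = 1 - t.
    rewrite scalerN -{1}[p]scale1r -scalerBl enormZ p1 mulr1 ger0_norm//; lra.
  split; first by rewrite /= pt; lra.
  by move=> /= pa; move: pt; rewrite pa; lra.
have [e e1 _] := unit_direction hn a.
apply: (closure_ray (u := e) ta) => t /andP[t0 t1].
have te : enorm (t *: e) = t by rewrite enormZ e1 mulr1 gtr0_norm.
split; first by have /= := enormD a (t *: e); rewrite te; lra.
move=> /= /(congr1 (fun x => enorm (x - a))).
by rewrite addrC addKr te subrr /enorm edot0l sqrtr0; lra.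
Qed.

End PuncturedBall.

(** * Conformal factors of Moebius transformations *)

Section Distortion.
Context {R : realType} {n : nat}.
Notation rVoo := (one_point_compactification 'rV[R]_n).
Implicit Types (a b c e p q u v x y : 'rV[R]_n) (s t : R) (z w : rVoo).
Implicit Types (F G : rVoo -> rVoo) (k : rVoo -> R).

(** The value 1 for pairs consisting of a finite point and the point at
infinity is the normalization under which inversions, which exchange their
centre with infinity, obey the same scaling rule as at finite points.  It
spares every distinction about infinity when maps are composed. *)
Definition sqdist z w : R :=
  match z, w with
  | Some x, Some y => edot (x - y) (x - y)
  | None, None => 0
  | _, _ => 1
  end.

(** At a finite point with a finite image, [k] is the scaling factor of the
derivative of [F]. *)
Definition conformal F k :=
  (forall z, 0 < k z) /\
  forall z w, sqdist (F z) (F w) = k z * k w * sqdist z w.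

Lemma conformal_comp F G k l : conformal F k -> conformal G l ->
  conformal (F \o G) (fun z => k (G z) * l z).
Proof.
move=> [k0 hF] [l0 hG]; split=> [z|z w /=]; first by rewrite mulr_gt0.
by rewrite hF hG; ring.
Qed.

Lemma conformal_inverse F G k : conformal F k -> cancel G F ->
  conformal G (fun w => (k (G w))^-1).
Proof.
move=> [k0 hF] GK; split=> [z|z w]; first by rewrite invr_gt0.
have := hF (G z) (G w); rewrite !GK => ->.
have := k0 (G z); have := k0 (G w) => h1 h2.
by field; rewrite !gt_eqF.
Qed.

(** The usual factor [r^2 / |x - c|^2] breaks down at [c] and at infinity, where
the values are forced by the scaling rule: pairs of [c] and a finite point give
[r^-2], pairs of infinity and a finite point give [r^2]. *)
Definition inversion_factor c r z : R :=
  match z with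
  | Some x => if x == c then (r ^+ 2)^-1 else r ^+ 2 / edot (x - c) (x - c)
  | None => r ^+ 2
  end.

Lemma inversion_conformal c r : 0 < r ->
  conformal (inversion c r) (inversion_factor c r).
Proof.
move=> r0; have rN0 : r != 0 by rewrite gt_eqF.
have r2 : r ^+ 2 != 0 by rewrite expf_neq0.
have dx x : x != c -> edot (x - c) (x - c) != 0 by rewrite edot_eq0 subr_eq0.
split=> [[x|]|[x|] [y|]] /=; rewrite ?exprn_gt0//.
- case: ifPn => xc; rewrite ?invr_gt0 ?divr_gt0 ?exprn_gt0//.
  by rewrite edot_gt0 subr_eq0.
- case: ifPn => [/eqP->|xc]; case: ifPn => [/eqP->|yc] //=.
  + by rewrite subrr edot0l mulr0.
  + by rewrite -[c - y]opprB edotNl edotNr opprK; field; rewrite ?rN0 ?dx.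
  + by field; rewrite ?rN0 ?dx.
  + rewrite !sqr_enorm; move: (dx _ xc) (dx _ yc).
    have -> : x - y = (x - c) - (y - c) by rewrite opprB addrA subrK.
    move: (x - c) (y - c) => X Y x0 y0.
    rewrite opprD addrACA subrr add0r !edotE [edot Y X]edotC.
    by field; rewrite y0 x0.
- case: ifPn => [_|xc] /=; first by rewrite mulr1 mulVf.
  by rewrite addrC addKr edotZl edotZr sqr_enorm; field; rewrite dx.
- case: ifPn => [_|xc] /=; first by rewrite mulr1 divff.
  rewrite opprD addNKr edotNl edotNr opprK.
  by rewrite edotZl edotZr sqr_enorm; field; rewrite dx.
- by rewrite subrr edot0l mulr0.
Qed.

Lemma reflection_conformal u t : u != 0 ->
  conformal (reflection u t) (fun=> 1).
Proof.
move=> u0; split=> [z|[x|] [y|]] //=; rewrite ?mulr1// ?mul1r//.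
rewrite !sqr_enorm; have u2 : edot u u != 0 by rewrite edot_eq0.
rewrite !edotE [edot u x]edotC [edot u y]edotC [edot y x]edotC.
by field.
Qed.

Lemma inversionK c r : 0 < r -> involutive (inversion c r).
Proof.
move=> r0 [x|] /=; last by rewrite eqxx.
case: ifPn => [/eqP->//|xc] /=.
have r2 : r ^+ 2 != 0 by rewrite expf_neq0// gt_eqF.
have d0 : edot (x - c) (x - c) != 0 by rewrite edot_eq0 subr_eq0.
rewrite -[X in _ == X]addr0 (inj_eq (addrI c)) scaler_eq0 subr_eq0 (negbTE xc).
rewrite sqr_enorm mulf_eq0 invr_eq0 (negbTE r2) (negbTE d0) /= addrAC subrr add0r.
rewrite scalerA sqr_enorm edotZl edotZr.
set A := (X in X *: _); have -> : A = 1 by rewrite /A; field; rewrite d0 gt_eqF.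
by rewrite scale1r addrC subrK.
Qed.

Lemma reflectionK u t : u != 0 -> involutive (reflection u t).
Proof.
move=> u0 [x|]//=; congr Some.
have u2 : edot u u != 0 by rewrite edot_eq0.
rewrite !sqr_enorm -addrA -!(scaleNr _ u) -scalerDl !edotE.
set A := (X in X *: _); have -> : A = 0 by rewrite /A; field.
by rewrite scale0r addr0.
Qed.

Lemma mobius_conformal F : mobius_transformation F -> exists k, conformal F k.
Proof.
elim=> {F} [c r r0|u t u0|F G _ [k hk] _ [l hl]].
- by exists (inversion_factor c r); exact: inversion_conformal.
- by exists (fun=> 1); exact: reflection_conformal.
- by eexists; exact: conformal_comp hk hl.
Qed.

Lemma mobius_bijective F : mobius_transformation F -> bijective F.
Proof.
elim=> {F} [c r r0|u t u0|F G _ bF _ bG].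
- by exists (inversion c r); exact: inversionK.
- by exists (reflection u t); exact: reflectionK.
- exact: bij_comp.
Qed.

End Distortion.

(** * Moebius transformations preserving the ball *)

Section BallAutomorphism.
Context {R : realType} {n : nat}.
Notation rVoo := (one_point_compactification 'rV[R]_n).
Implicit Types (a b c e p q u v x y : 'rV[R]_n) (s t : R) (z w : rVoo).
Implicit Types (F G : rVoo -> rVoo) (k : rVoo -> R).

Definition stabilizes_ball F :=
  F @` (Some @` unit_ball R n) = Some @` unit_ball R n.

Lemma stabilizes_ball_inverse F G :
  stabilizes_ball F -> cancel F G -> stabilizes_ball G.
Proof.
move=> FB FK; rewrite /stabilizes_ball -{1}FB (image_comp F G).
by rewrite (_ : G \o F = id) ?image_id//; apply/funext => z /=.
Qed.

Lemma stabilizes_ball_image F x : stabilizes_ball F -> unit_ball R n x ->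
  exists2 y, unit_ball R n y & F (Some x) = Some y.
Proof.
move=> FB xB; have : (Some @` unit_ball R n) (F (Some x)).
  by rewrite -FB; do 2![apply: imageP].
by move=> [y yB] <-; exists y.
Qed.

Lemma stabilizes_ball_preimage F y : stabilizes_ball F -> unit_ball R n y ->
  exists2 x, unit_ball R n x & F (Some x) = Some y.
Proof.
move=> FB yB; have : (F @` (Some @` unit_ball R n)) (Some y).
  by rewrite FB; apply: imageP.
by move=> [_ [x xB <-]] Fx; exists x.
Qed.

Lemma edotB_le4 x y : enorm x <= 1 -> enorm y <= 1 -> edot (x - y) (x - y) <= 4.
Proof.
move=> x1 y1; rewrite -sqr_enorm (_ : 4 = 2 ^+ 2); last by ring.
rewrite ler_sqr ?nnegrE ?enorm_ge0//.
by have := enormD x (- y); rewrite enormN; lra.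
Qed.

(** Continuity of [F] at [p], read off the scaling rule: as [x = (1 - s) p]
tends to [p], [|F x - F p|^2 = k x * k p * s^2] tends to zero, because [k x]
stays bounded.  The bound on [k x] is the scaling rule for [x] and [0], whose
images lie in the ball and so are at distance at most 2. *)
Lemma sphere_image_approx F k p eps : conformal F k -> stabilizes_ball F ->
  enorm p = 1 -> 0 < eps ->
  exists2 y, unit_ball R n y & sqdist (Some y) (F (Some p)) < eps.
Proof.
move=> [k0 hF] FB p1 eps0.
have [a aB Fa] := stabilizes_ball_image FB unit_ball0.
have pp := (enorm_eq1 p).1 p1.
pose C := k (Some p) * (16 / k (Some 0)).
have C0 : 0 < C by rewrite mulr_gt0// divr_gt0.
(* [s <= 1/2] keeps [x] away from [0], which bounds its factor by
   [16 / k 0]; then [C * s^2 <= eps / 2]. *)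
pose s := Num.min 2^-1 (eps / C).
have s0 : 0 < s by rewrite lt_min invr_gt0 ltr0n divr_gt0.
have s2 : s <= 2^-1 by rewrite ge_min lexx.
have sC : C * s <= eps.
  by rewrite mulrC -ler_pdivlMr// ge_min lexx orbT.
have xB : unit_ball R n ((1 - s) *: p).
  by rewrite /unit_ball/= enormZ p1 mulr1 ger0_norm; lra.
have [y yB Fx] := stabilizes_ball_image FB xB.
exists y => //; rewrite -Fx hF /=.
have -> : (1 - s) *: p - p = - (s *: p).
  by rewrite scalerBl scale1r addrC addKr.
rewrite edotNl edotNr opprK edotZl edotZr pp mulr1.
have kx : k (Some ((1 - s) *: p)) <= 16 / k (Some 0).
  rewrite ler_pdivlMr//.
  have := hF (Some ((1 - s) *: p)) (Some 0); rewrite Fx Fa /= subr0.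
  rewrite edotZl edotZr pp mulr1 => hk.
  have := edotB_le4 (ltW yB) (ltW aB); rewrite hk.
  set K := k _ * k _ => hK; have K0 : 0 < K by rewrite mulr_gt0.
  have : K * (2^-1 * 2^-1) <= K * ((1 - s) * (1 - s)).
    by rewrite (ler_wpM2l (ltW K0))// ler_pM ?invr_ge0//; lra.
  by lra.
have : k (Some ((1 - s) *: p)) * k (Some p) <= C.
  by rewrite mulrC /C ler_wpM2l// ltW.
move=> /(ler_wpM2r (ltW (mulr_gt0 s0 s0))) h; apply: le_lt_trans h _.
rewrite mulrA; have : C * s * s <= eps * 2^-1
  by exact: (ler_pM (mulr_ge0 (ltW C0) (ltW s0)) (ltW s0) sC s2).
by lra.
Qed.

(** The image of a point of the sphere is a limit of points of the ball, so it
is finite and in the closed ball; it is not in the open ball, whose points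
already come from the ball and [F] is injective. *)
Lemma sphere_image F k p : conformal F k -> stabilizes_ball F -> enorm p = 1 ->
  exists2 q, enorm q = 1 & F (Some p) = Some q.
Proof.
move=> Fk FB p1; have happ := sphere_image_approx Fk FB p1.
case Fp : (F (Some p)) => [q|]; last first.
  by have [y _] := happ 1 ltr01; rewrite Fp /= ltxx.
exists q => //; apply/eqP; rewrite eq_le !leNgt; apply/andP; split; apply/negP.
  rewrite -subr_gt0 => q1; have [y yB] := happ _ (exprn_gt0 2 q1).
  rewrite Fp /= -sqr_enorm ltr_sqr ?nnegrE ?enorm_ge0// ?ltW//.
  have := enormD y (q - y); rewrite addrC subrK (enormB q y).
  by move: yB; rewrite /unit_ball/=; lra.
move=> qB; have [x xB Fx] := stabilizes_ball_preimage FB qB.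
have := Fk.2 (Some x) (Some p); rewrite Fx Fp /= subrr edot0l => /esym/eqP.
rewrite !mulf_eq0 !(gt_eqF (Fk.1 _)) /= edot_eq0 subr_eq0 => /eqP xp.
by move: xB; rewrite /unit_ball/= xp p1 ltxx.
Qed.

Lemma edotB_sphere q e t : enorm q = 1 -> enorm e = 1 ->
  edot (q - t *: e) (q - t *: e) = 1 + t ^+ 2 - 2 * t * edot q e.
Proof.
move=> /enorm_eq1 q1 /enorm_eq1 e1.
by rewrite !edotE [edot e q]edotC q1 e1; ring.
Qed.

Lemma conformal_center F k p q a : conformal F k -> enorm p = 1 ->
  F (Some p) = Some q -> F (Some 0) = Some a ->
  k (Some p) * k (Some 0) = enorm (q - a) ^+ 2.
Proof.
move=> Fk p1 Fp F0; have := Fk.2 (Some p) (Some 0).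
by rewrite Fp F0 /= subr0 ((enorm_eq1 p).1 p1) mulr1 sqr_enorm => <-.
Qed.

(** Write [al] for [|a|], [e] for the direction of [a], and let [p1], [p2] be
the points of the sphere sent to [e] and [- e].  The scaling rule for [p1] and
[p2], with [|p1 - p2| <= 2], gives [k 0 <= 1 - al^2].  For the converse let
[w] be the image of [- p1] and [tau] its inner product with [e].  The scaling
rule for the antipodal pair [p1], [- p1], with [|p1 - (- p1)| = 2], determines
[k 0] in terms of [tau]:
[(2 - 2 tau) (k 0)^2 = 4 (1 - al)^2 (1 + al^2 - 2 al tau)], and
[tau >= -1] forces [k 0 >= 1 - al^2]. *)
Lemma center_factor (hn : (0 < n)%N) F G k a : conformal F k -> stabilizes_ball F ->
  cancel F G -> cancel G F -> F (Some 0) = Some a -> unit_ball R n a ->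
  k (Some 0) = 1 - enorm a ^+ 2.
Proof.
move=> Fk FB FK GK F0 aB.
have Gk := conformal_inverse Fk GK.
have GB := stabilizes_ball_inverse FB FK.
have [e e1 ae] := unit_direction hn a.
set al := enorm a in ae *; set k0 := k (Some 0).
have al0 : 0 <= al := enorm_ge0 a.
have al1 : al < 1 := aB.
have k0_gt0 : 0 < k0 := Fk.1 _.
have al2 : 0 <= 1 - al ^+ 2 by rewrite subr_ge0 expr_le1// ltW.
have kp p q : enorm p = 1 -> enorm q = 1 -> F (Some p) = Some q ->
    k (Some p) * k0 = 1 + al ^+ 2 - 2 * al * edot q e.
  move=> p1 q1 Fp; rewrite -(edotB_sphere _ q1 e1) -ae.
  by rewrite -sqr_enorm; exact: conformal_center Fk p1 Fp F0.
have e1' : enorm (- e) = 1 by rewrite enormN.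
have ee := (enorm_eq1 e).1 e1.
have [p1 p1S Gp1] := sphere_image Gk GB e1.
have [p2 p2S Gp2] := sphere_image Gk GB e1'.
have Fp1 : F (Some p1) = Some e by rewrite -Gp1 GK.
have Fp2 : F (Some p2) = Some (- e) by rewrite -Gp2 GK.
have h1 : k (Some p1) * k0 = (1 - al) ^+ 2 by rewrite (kp _ e)// ee; ring.
have h2 : k (Some p2) * k0 = (1 + al) ^+ 2.
  by rewrite (kp _ (- e))// edotNl ee; ring.
have k0_le : k0 <= 1 - al ^+ 2.
  rewrite -ler_sqr ?nnegrE ?(ltW k0_gt0)//.
  have h12 : k (Some p1) * k (Some p2) * edot (p1 - p2) (p1 - p2) = 4.
    have := Fk.2 (Some p1) (Some p2); rewrite Fp1 Fp2 /= => <-.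
    by rewrite !edotE ee; ring.
  have d4 : edot (p1 - p2) (p1 - p2) <= 4 by rewrite edotB_le4 ?p1S ?p2S.
  have : 4 * k0 ^+ 2 <= (1 - al ^+ 2) ^+ 2 * 4; last by lra.
  have -> : 4 * k0 ^+ 2 = (k (Some p1) * k0) * (k (Some p2) * k0)
      * edot (p1 - p2) (p1 - p2).
    by rewrite -h12; ring.
  by rewrite h1 h2 -exprMn -subr_sqr expr1n ler_wpM2l// sqr_ge0.
have p1S' : enorm (- p1) = 1 by rewrite enormN.
have [w wS Fw] := sphere_image Fk FB p1S'.
have h3 := kp _ _ p1S' wS Fw.
have h4 : (2 - 2 * edot w e) = k (Some p1) * k (Some (- p1)) * 4.
  have := Fk.2 (Some p1) (Some (- p1)); rewrite Fp1 Fw /= opprK.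
  have := (enorm_eq1 w).1 wS; have := (enorm_eq1 p1).1 p1S.
  by rewrite !edotE [edot e w]edotC ee => -> ->; lra.
have [tau_ge tau_le] : -1 <= edot w e /\ edot w e <= 1.
  by have := edot_le w e; rewrite wS e1 mulr1 ler_norml => /andP[].
set tau := edot w e in h3 h4 tau_ge tau_le.
have h5 : (2 - 2 * tau) * k0 ^+ 2 = 4 * (1 - al) ^+ 2 * (1 + al ^+ 2 - 2 * al * tau).
  by rewrite h4 -h1 -h3; ring.
apply/eqP; rewrite eq_le k0_le /= leNgt; apply/negP => k0_lt.
have k0_sq : k0 ^+ 2 < (1 - al ^+ 2) ^+ 2 by rewrite ltr_sqr ?nnegrE// ltW.
have al4 : 0 < (1 - al) ^+ 4 by rewrite exprn_gt0// subr_gt0.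
have [tau1|tau1] := eqVneq tau 1.
  by move: h5; rewrite tau1; lra.
have : (2 - 2 * tau) * k0 ^+ 2 < (2 - 2 * tau) * (1 - al ^+ 2) ^+ 2.
  have : tau < 1 by rewrite lt_neqAle tau1.
  by move=> tau_lt; rewrite ltr_pM2l//; lra.
(* The right-hand side of [h5] exceeds [(2 - 2 tau) (1 - al^2)^2] by exactly
   [(1 - al)^4 (2 + 2 tau)]. *)
have : 0 <= (1 - al) ^+ 4 * (2 + 2 * tau) by rewrite mulr_ge0 ?(ltW al4)//; lra.
by rewrite h5; lra.
Qed.

End BallAutomorphism.

(** * The Cassinian metric under a Moebius transformation *)

Section Cassinian.
Context {R : realType} {n : nat}.
Notation rVoo := (one_point_compactification 'rV[R]_n).
Implicit Types (a b c e p q u v x y : 'rV[R]_n) (s t : R) (z w : rVoo).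
Implicit Types (F G : rVoo -> rVoo) (k : rVoo -> R).

Definition cassinian_ratio x y p : R :=
  enorm (x - y) / (enorm (x - p) * enorm (p - y)).

(** With [h = sqrt k], distances are multiplied by [h x * h y] in the numerator
and by [h x * h p * h p * h y] in the denominator. *)
Lemma cassinian_ratio_conformal F k x y p x' y' p' : conformal F k ->
  F (Some x) = Some x' -> F (Some y) = Some y' -> F (Some p) = Some p' ->
  cassinian_ratio x y p = k (Some p) * cassinian_ratio x' y' p'.
Proof.
move=> [k0 hF] Fx Fy Fp.
have dist u v u' v' : F (Some u) = Some u' -> F (Some v) = Some v' ->
    enorm (u' - v') = Num.sqrt (k (Some u)) * Num.sqrt (k (Some v)) * enorm (u - v).
  move=> Fu Fv; have := hF (Some u) (Some v); rewrite Fu Fv /= => e.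
  by rewrite /enorm e !sqrtrM ?mulr_ge0 ?(ltW (k0 _)).
rewrite /cassinian_ratio (dist _ _ _ _ Fx Fy) (dist _ _ _ _ Fx Fp).
rewrite (dist _ _ _ _ Fp Fy) -{1}(sqr_sqrtr (ltW (k0 (Some p)))) !invfM.
have s0 z : Num.sqrt (k z) != 0 by rewrite gt_eqF// sqrtr_gt0.
move: (enorm (x - p))^-1 (enorm (p - y))^-1 => X Y.
by field; rewrite !s0.
Qed.

Lemma boundary_distance_gt0 b x : (0 < n)%N -> unit_ball R n b ->
  (unit_ball R n `\ b) x ->
  exists2 m : R, 0 < m &
    forall p, boundary (unit_ball R n `\ b) p -> m <= enorm (x - p).
Proof.
move=> hn bB [xB xb]; exists (Num.min (1 - enorm x) (enorm (x - b))).
  rewrite lt_min subr_gt0 enorm_gt0 subr_eq0; apply/andP; split => //.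
  exact/eqP.
move=> p /(boundary_punctured_ball _ hn bB) [p1|->]; rewrite ge_min; last first.
  by rewrite lexx orbT.
by have := enormD x (p - x); rewrite addrC subrK p1 (enormB p x) => h; rewrite lerBlDl h.
Qed.

(** Points of the domain stay at positive distance from the boundary, which
bounds the ratios: the supremum is a genuine one. *)
Lemma cassinian_ratio_le b x y p : (0 < n)%N -> unit_ball R n b ->
  (unit_ball R n `\ b) x -> (unit_ball R n `\ b) y ->
  boundary (unit_ball R n `\ b) p ->
  cassinian_ratio x y p <= cassinian (unit_ball R n `\ b) x y.
Proof.
move=> hn bB xD yD pD; apply: ub_le_sup; last by exists p.
have [mx mx0 hx] := boundary_distance_gt0 hn bB xD.
have [my my0 hy] := boundary_distance_gt0 hn bB yD.
exists (enorm (x - y) / (mx * my)) => _ [q qD <-].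
rewrite ler_wpM2l ?enorm_ge0// lef_pV2 ?posrE ?mulr_gt0//.
- by rewrite (enormB q) ler_pM ?hx ?hy// ltW.
- exact: lt_le_trans mx0 (hx _ qD).
- by rewrite (enormB q); exact: lt_le_trans my0 (hy _ qD).
Qed.

Lemma cassinian_le b x y t : (0 < n)%N -> unit_ball R n b ->
  (forall p, enorm p = 1 \/ p = b -> cassinian_ratio x y p <= t) ->
  cassinian (unit_ball R n `\ b) x y <= t.
Proof.
move=> hn bB ht; apply: ge_sup; last first.
  by move=> _ [p /(boundary_punctured_ball _ hn bB) /ht pt <-].
by eexists; exists b; [apply/boundary_punctured_ball => //; right|reflexivity].
Qed.

(** One lemma for both inequalities: it will be applied to a Moebius map, from
puncture [0] to puncture [a], and to its inverse, from [a] to [0]. *)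
Lemma cassinian_conformal_le F k M b a x y x' y' : (0 < n)%N ->
  conformal F k -> stabilizes_ball F ->
  unit_ball R n b -> unit_ball R n a -> F (Some b) = Some a ->
  (forall p, enorm p = 1 \/ p = b -> k (Some p) <= M) ->
  (unit_ball R n `\ a) x' -> (unit_ball R n `\ a) y' ->
  F (Some x) = Some x' -> F (Some y) = Some y' ->
  cassinian (unit_ball R n `\ b) x y <= M * cassinian (unit_ball R n `\ a) x' y'.
Proof.
move=> hn Fk FB bB aB Fb kM x'D y'D Fx Fy; apply: cassinian_le => // p hp.
have [q qD Fp] : exists2 q, boundary (unit_ball R n `\ a) q & F (Some p) = Some q.
  case: hp => [/(sphere_image Fk FB)[q q1 Fp]|->].
    by exists q => //; apply/boundary_punctured_ball => //; left.
  by exists a => //; apply/boundary_punctured_ball => //; right.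
rewrite (cassinian_ratio_conformal Fk Fx Fy Fp).
apply: ler_pM; [exact: ltW (Fk.1 _)| |exact: kM|exact: cassinian_ratio_le].
by rewrite divr_ge0 ?mulr_ge0 ?enorm_ge0.
Qed.

(** Beyond radius 1/2 on the radius ending at [q], no boundary point is closer
than [q]: the sphere is at distance [1 - s] for the point [s *: q], attained at
[q], and the puncture [b], lying in the opposite half-space, is at distance at
least [s >= 1 - s]. *)
Lemma cassinian_radial b q s t : (0 < n)%N -> unit_ball R n b ->
  enorm q = 1 -> edot q b <= 0 -> 2^-1 <= s < 1 -> 2^-1 <= t < 1 ->
  cassinian (unit_ball R n `\ b) (s *: q) (t *: q)
    <= cassinian_ratio (s *: q) (t *: q) q.
Proof.
move=> hn bB q1 qb hs ht; apply: cassinian_le => // p hp.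
have far r : 2^-1 <= r < 1 ->
    0 < enorm (r *: q - q) /\ enorm (r *: q - q) <= enorm (r *: q - p).
  move=> /andP[r2 r1].
  have -> : enorm (r *: q - q) = 1 - r.
    rewrite -{2}[q]scale1r -scalerBl enormZ q1 mulr1 ler0_norm ?opprB//; lra.
  split; first lra.
  case: hp => [p1|->].
    have := enormD (r *: q) (p - r *: q); rewrite addrC subrK p1 enormZ q1.
    by rewrite (enormB p) mulr1 ger0_norm; lra.
  rewrite -ler_sqr ?nnegrE ?enorm_ge0//; last by lra.
  rewrite sqr_enorm !edotE [edot b q]edotC ((enorm_eq1 q).1 q1).
  have := edot_ge0 b.
  have : 0 <= r * - edot q b by rewrite mulr_ge0; lra.
  by lra.
have [s0 sp] := far s hs; have [t0 tp] := far t ht.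
rewrite /cassinian_ratio (enormB q) (enormB p).
rewrite ler_wpM2l ?enorm_ge0// lef_pV2 ?posrE ?mulr_gt0//.
- by rewrite ler_pM ?enorm_ge0.
- exact: lt_le_trans s0 sp.
- exact: lt_le_trans t0 tp.
Qed.

End Cassinian.

(** * Distortion bounds and their sharpness *)

Section PuncturedBallMobius.
Context {R : realType} {n : nat}.
Notation rVoo := (one_point_compactification 'rV[R]_n).
Implicit Types (a b c e p q u v x y : 'rV[R]_n) (s t : R) (z w : rVoo).
Implicit Types (F G : rVoo -> rVoo) (k : rVoo -> R).

Lemma boundary_factor_bounds (hn : (0 < n)%N) F G k a :
  conformal F k -> stabilizes_ball F -> cancel F G -> cancel G F ->
  F (Some 0) = Some a -> unit_ball R n a ->
  forall p, enorm p = 1 \/ p = 0 ->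
  (1 - enorm a) / (1 + enorm a) <= k (Some p) <= (1 + enorm a) / (1 - enorm a).
Proof.
move=> Fk FB FK GK F0 aB p hp.
have k0 := center_factor hn Fk FB FK GK F0 aB.
have al0 := enorm_ge0 a; have al1 : enorm a < 1 := aB.
have d0 : 0 < 1 - enorm a by lra.
have d1 : 0 < 1 + enorm a by lra.
have d01 : 0 < (1 - enorm a) * (1 + enorm a) by rewrite mulr_gt0.
case: hp => [p1|->]; last first.
  rewrite k0 ler_pdivrMr// ler_pdivlMr//.
  apply/andP; split; rewrite -subr_ge0.
    have -> : (1 - enorm a ^+ 2) * (1 + enorm a) - (1 - enorm a) =
      (1 - enorm a) * (1 + enorm a) * enorm a + (1 - enorm a) * enorm a by ring.
    by rewrite addr_ge0// mulr_ge0// ltW.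
  have -> : 1 + enorm a - (1 - enorm a ^+ 2) * (1 - enorm a) =
      enorm a * (1 + (1 - enorm a) * (1 + enorm a)) + enorm a ^+ 2 by ring.
  by rewrite addr_ge0 ?sqr_ge0// mulr_ge0// addr_ge0// ltW.
have [q q1 Fp] := sphere_image Fk FB p1.
have := conformal_center Fk p1 Fp F0; rewrite k0 => hk.
have le1 : 1 - enorm a <= enorm (q - a).
  by have := enormD (q - a) a; rewrite subrK q1; lra.
have le2 : enorm (q - a) <= 1 + enorm a.
  by have := enormD q (- a); rewrite enormN q1; lra.
have sq1 : (1 - enorm a) ^+ 2 <= k (Some p) * (1 - enorm a ^+ 2).
  by rewrite hk ler_sqr ?nnegrE ?enorm_ge0// ltW.
have sq2 : k (Some p) * (1 - enorm a ^+ 2) <= (1 + enorm a) ^+ 2.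
  by rewrite hk ler_sqr ?nnegrE ?enorm_ge0// ltW.
rewrite ler_pdivrMr// ler_pdivlMr//; apply/andP; split.
  by rewrite -(ler_pM2r d0); lra.
by rewrite -(ler_pM2r d1); lra.
Qed.

(** The data extracted from [f] on which all later arguments rest: the extension
[F] with its inverse and conformal factor, and the bijection induced between the
two punctured balls.  [F] preserves the whole ball, since it also sends the
puncture to the puncture. *)
Variant ball_automorphism_spec a (f : 'rV[R]_n -> 'rV[R]_n) : Prop :=
  BallAutomorphismSpec F G k of conformal F k & stabilizes_ball F &
    cancel F G & cancel G F & F (Some 0) = Some a &
    (forall x, (unit_ball R n `\ 0) x ->
       (unit_ball R n `\ a) (f x) /\ F (Some x) = Some (f x)) &
    (forall y, (unit_ball R n `\ a) y ->
       exists2 x, (unit_ball R n `\ 0) x & f x = y).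

Lemma punctured_ball_mobiusP a (f : 'rV[R]_n -> 'rV[R]_n) :
  unit_ball R n a -> punctured_ball_mobius a f -> ball_automorphism_spec a f.
Proof.
move=> aB [F [Fm Ff fB F0]].
have [k Fk] := mobius_conformal Fm; have [G FK GK] := mobius_bijective Fm.
have fD x : (unit_ball R n `\ 0) x -> (unit_ball R n `\ a) (f x).
  by move=> xD; rewrite -fB; exists x.
have fS y : (unit_ball R n `\ a) y -> exists2 x, (unit_ball R n `\ 0) x & f x = y.
  by rewrite -fB.
apply: (BallAutomorphismSpec Fk _ FK GK F0) => //; last first.
  by move=> x xD; split; [exact: fD|exact: Ff].
apply/seteqP; split=> [_ [_ [x xB <-] <-]|_ [y yB <-]].
  have [->|/eqP x0] := eqVneq x 0; first by exists a.
  by have [fxB _] := fD x (conj xB x0); exists (f x) => //; rewrite Ff.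
have [->|/eqP ya] := eqVneq y a.
  by exists (Some 0) => //; exists 0 => //; exact: unit_ball0.
have [x xD fx] := fS y (conj yB ya).
by exists (Some x); [exists x => //; case: xD|rewrite Ff// fx].
Qed.

(** The inverse map has factor [1 / k], which is at most the inverse of the
lower bound on [k]. *)
Lemma distortion_upper (hn : (0 < n)%N) a f x y :
  unit_ball R n a -> punctured_ball_mobius a f ->
  (unit_ball R n `\ 0) x -> (unit_ball R n `\ 0) y ->
  cassinian (unit_ball R n `\ a) (f x) (f y)
    <= (1 + enorm a) / (1 - enorm a) * cassinian (unit_ball R n `\ 0) x y.
Proof.
move=> aB; have al0 := enorm_ge0 a; have al1 : enorm a < 1 := aB.
have m0 : 0 < (1 - enorm a) / (1 + enorm a) by rewrite divr_gt0; lra.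
move=> /(punctured_ball_mobiusP aB) [F G k Fk FB FK GK F0 Ff _] xD yD.
have Gk := conformal_inverse Fk GK; have GB := stabilizes_ball_inverse FB FK.
have Ga : G (Some a) = Some 0 by rewrite -F0 FK.
have Gf u : (unit_ball R n `\ 0) u -> G (Some (f u)) = Some u.
  by move=> /Ff[_ <-]; rewrite FK.
apply: (cassinian_conformal_le hn Gk GB aB unit_ball0 Ga _ xD yD (Gf _ xD) (Gf _ yD)).
move=> q hq.
have [p hp ->] : exists2 p, enorm p = 1 \/ p = 0 & G (Some q) = Some p.
  case: hq => [/(sphere_image Gk GB)[p p1 ->]|->]; first by exists p => //; left.
  by exists 0 => //; right.
have /andP[kp _] := boundary_factor_bounds hn Fk FB FK GK F0 aB hp.
by rewrite -(invf_div (1 - enorm a)) lef_pV2 ?posrE ?(Fk.1 (Some p)).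
Qed.

Lemma distortion_lower (hn : (0 < n)%N) a f x y :
  unit_ball R n a -> punctured_ball_mobius a f ->
  (unit_ball R n `\ 0) x -> (unit_ball R n `\ 0) y ->
  (1 - enorm a) / (1 + enorm a) * cassinian (unit_ball R n `\ 0) x y
    <= cassinian (unit_ball R n `\ a) (f x) (f y).
Proof.
move=> aB; have al0 := enorm_ge0 a; have al1 : enorm a < 1 := aB.
have m0 : 0 < (1 - enorm a) / (1 + enorm a) by rewrite divr_gt0; lra.
move=> /(punctured_ball_mobiusP aB) [F G k Fk FB FK GK F0 Ff _] xD yD.
have [fxD Fx] := Ff _ xD; have [fyD Fy] := Ff _ yD.
rewrite mulrC -(ler_pdivlMr _ _ m0) mulrC invf_div.
apply: (cassinian_conformal_le hn Fk FB unit_ball0 aB F0 _ fxD fyD Fx Fy).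
move=> p /(boundary_factor_bounds hn Fk FB FK GK F0 aB).
by move=> /andP[].
Qed.

Lemma radial_punctured_ball b q s : unit_ball R n b ->
  enorm q = 1 -> edot q b <= 0 -> 0 < s < 1 -> (unit_ball R n `\ b) (s *: q).
Proof.
move=> bB q1 qb /andP[s0 s1]; split.
  by rewrite /unit_ball/= enormZ q1 mulr1 gtr0_norm.
move=> /= eb; move: qb; rewrite -eb edotZr ((enorm_eq1 q).1 q1) mulr1.
by lra.
Qed.

(** Among all points of the sphere, [- e] is the farthest from [a], so the
point [p] it comes from has the largest factor.  Choosing the pair radially in
the target, towards [- e], the metric there is the ratio at [- e], while that
of the source is at least the ratio at [p], larger by the extreme factor. *)
Lemma distortion_lower_attained (hn : (0 < n)%N) a f :
  unit_ball R n a -> punctured_ball_mobius a f ->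
  exists x y, [/\ (unit_ball R n `\ 0) x, (unit_ball R n `\ 0) y, x <> y &
    (1 - enorm a) / (1 + enorm a) * cassinian (unit_ball R n `\ 0) x y
      = cassinian (unit_ball R n `\ a) (f x) (f y)].
Proof.
move=> aB fm; have al0 := enorm_ge0 a; have al1 : enorm a < 1 := aB.
have m0 : 0 < (1 - enorm a) / (1 + enorm a) by rewrite divr_gt0; lra.
have [F G k Fk FB FK GK F0 Ff fS] := punctured_ball_mobiusP aB fm.
have Gk := conformal_inverse Fk GK; have GB := stabilizes_ball_inverse FB FK.
have [e e1 ae] := unit_direction hn a.
have q1 : enorm (- e) = 1 by rewrite enormN.
have qa : edot (- e) a <= 0.
  by rewrite ae edotNl edotZr ((enorm_eq1 e).1 e1) mulr1 oppr_le0.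
have [p p1 Gp] := sphere_image Gk GB q1.
have Fp : F (Some p) = Some (- e) by rewrite -Gp GK.
have kp : k (Some p) = (1 + enorm a) / (1 - enorm a).
  have := conformal_center Fk p1 Fp F0.
  rewrite (center_factor hn Fk FB FK GK F0 aB).
  rewrite [X in - e - X]ae -{1}[e]scale1r -opprD -scalerDl enormN enormZ e1 mulr1.
  rewrite ger0_norm ?addr_ge0// => hk.
  apply/eqP; rewrite -(inj_eq (mulIf (_ : 1 - enorm a ^+ 2 != 0))).
    by rewrite hk; apply/eqP; field; lra.
  by rewrite subr_eq0 eq_sym lt_eqF// expr_lt1.
have [x xD fx] := fS _ (radial_punctured_ball (s := 2^-1) aB q1 qa ltac:(lra)).
have [y yD fy] := fS _ (radial_punctured_ball (s := 3 / 4) aB q1 qa ltac:(lra)).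
exists x, y; split => //.
  move=> xy; have : enorm (2^-1 *: - e) = enorm ((3 / 4) *: - e).
    by rewrite -fx -fy xy.
  by rewrite !enormZ q1 !mulr1 !ger0_norm; lra.
apply/eqP; rewrite eq_le distortion_lower//=.
rewrite fx fy; apply: le_trans (cassinian_radial hn aB q1 qa _ _) _; try lra.
have [_ Fx] := Ff _ xD; have [_ Fy] := Ff _ yD; rewrite fx in Fx; rewrite fy in Fy.
rewrite [X in _ <= X]mulrC -(ler_pdivrMr _ _ m0) mulrC invf_div -kp.
rewrite -(cassinian_ratio_conformal Fk Fx Fy Fp).
apply: cassinian_ratio_le => //; first exact: unit_ball0.
by apply/boundary_punctured_ball => //; [exact: unit_ball0|left].
Qed.

(** Dually, [e] is the point of the sphere nearest to [a], so the point [p] it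
comes from has the smallest factor; the pair is chosen radially in the source,
towards [p]. *)
Lemma distortion_upper_attained (hn : (0 < n)%N) a f :
  unit_ball R n a -> punctured_ball_mobius a f ->
  exists x y, [/\ (unit_ball R n `\ 0) x, (unit_ball R n `\ 0) y, x <> y &
    cassinian (unit_ball R n `\ a) (f x) (f y)
      = (1 + enorm a) / (1 - enorm a) * cassinian (unit_ball R n `\ 0) x y].
Proof.
move=> aB fm; have al0 := enorm_ge0 a; have al1 : enorm a < 1 := aB.
have m0 : 0 < (1 - enorm a) / (1 + enorm a) by rewrite divr_gt0; lra.
have [F G k Fk FB FK GK F0 Ff fS] := punctured_ball_mobiusP aB fm.
have Gk := conformal_inverse Fk GK; have GB := stabilizes_ball_inverse FB FK.
have [e e1 ae] := unit_direction hn a.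
have [p p1 Gp] := sphere_image Gk GB e1.
have Fp : F (Some p) = Some e by rewrite -Gp GK.
have kp : k (Some p) = (1 - enorm a) / (1 + enorm a).
  have := conformal_center Fk p1 Fp F0.
  rewrite (center_factor hn Fk FB FK GK F0 aB).
  rewrite [X in e - X]ae -{1}[e]scale1r -scalerBl enormZ e1 mulr1.
  rewrite ger0_norm ?subr_ge0 ?ltW// => hk.
  apply/eqP; rewrite -(inj_eq (mulIf (_ : 1 - enorm a ^+ 2 != 0))).
    by rewrite hk; apply/eqP; field; lra.
  by rewrite subr_eq0 eq_sym lt_eqF// expr_lt1.
have p0 : edot p 0 <= 0 by rewrite edotC edot0l.
have xD := radial_punctured_ball (s := 2^-1) unit_ball0 p1 p0 ltac:(lra).
have yD := radial_punctured_ball (s := 3 / 4) unit_ball0 p1 p0 ltac:(lra).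
exists (2^-1 *: p), ((3 / 4) *: p); split => //.
  move=> /(congr1 (@enorm R n)).
  by rewrite !enormZ p1 !mulr1 !ger0_norm; lra.
apply/eqP; rewrite eq_le distortion_upper//=.
have [fxD Fx] := Ff _ xD; have [fyD Fy] := Ff _ yD.
rewrite -(invf_div (1 - enorm a)) mulrC (ler_pdivrMr _ _ m0).
apply: le_trans (cassinian_radial hn unit_ball0 p1 p0 _ _) _; try lra.
rewrite (cassinian_ratio_conformal Fk Fx Fy Fp) kp [X in X <= _]mulrC.
rewrite (ler_wpM2r (ltW m0))//.
apply: cassinian_ratio_le => //.
by apply/boundary_punctured_ball => //; left.
Qed.

(** For an involution, being into the ball is enough to be onto it. *)
Lemma involution_punctured_ball_mobius a F (f : 'rV[R]_n -> 'rV[R]_n) :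
  mobius_transformation F -> involutive F -> F (Some 0) = Some a ->
  (forall x, unit_ball R n x -> F (Some x) = Some (f x) /\ unit_ball R n (f x)) ->
  punctured_ball_mobius a f.
Proof.
move=> Fm FK F0 Ff; exists F; split=> // [x [xB _]|]; first by have [] := Ff x xB.
have Fa : F (Some a) = Some 0 by rewrite -F0 FK.
have ffK x : unit_ball R n x -> f (f x) = x.
  move=> xB; have [Fx fxB] := Ff x xB; have [Ffx _] := Ff _ fxB.
  by move: Ffx; rewrite -Fx FK => -[].
have f0 : f 0 = a by have [] := Ff 0 unit_ball0; rewrite F0 => -[].
apply/seteqP; split=> [_ [x [xB x0] <-]|y [yB ya]].
  have [Fx fxB] := Ff x xB; split=> // fxa; apply: x0.
  by move: Fx; rewrite fxa -F0 => /(can_inj FK) [].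
exists (f y); last exact: ffK.
have [Fy fyB] := Ff y yB; split=> // fy0; apply: ya.
by rewrite /= -(ffK y yB) fy0 f0.
Qed.

(** For [a != 0] take the inversion centred at [c = a / |a|^2], the mirror image
of [a] in the unit sphere, with [r^2 = |c|^2 - 1], so that the sphere of
inversion is orthogonal to the unit sphere.  Orthogonality gives
[1 - |f x|^2 = r^2 / |x - c|^2 * (1 - |x|^2)], hence the ball is preserved. *)
Lemma exists_punctured_ball_mobius (hn : (0 < n)%N) a : unit_ball R n a ->
  exists f, punctured_ball_mobius a f.
Proof.
move=> aB; have [e e1 ae] := unit_direction hn a.
have e0 : e != 0 by rewrite -enorm_gt0 e1.
have ee := (enorm_eq1 e).1 e1.
have [a0|a_neq0] := eqVneq (enorm a) 0.
  exists (fun x => x - (2 * (edot x e - 0) / enorm e ^+ 2) *: e).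
  apply: involution_punctured_ball_mobius (mobius_reflection 0 e0) _ _ _.
  - exact: reflectionK.
  - by rewrite /= edot0l subr0 mulr0 mul0r scale0r subr0 ae a0 scale0r.
  move=> x xB; split=> //; move: xB; rewrite /unit_ball/= !enorm_lt1 e1 subr0.
  by rewrite !edotE [edot e x]edotC ee; lra.
have al1 : enorm a < 1 := aB.
have al0 : 0 < enorm a by rewrite lt0r a_neq0 enorm_ge0.
have [c cE] : exists c, c = (enorm a)^-1 *: e by eexists.
pose t := (enorm a)^-1; pose r := Num.sqrt (t ^+ 2 - 1).
have t1 : 1 < t by rewrite invf_gt1.
have t2 : 0 < t ^+ 2 - 1 by rewrite subr_gt0 exprn_egt1.
have r0 : 0 < r by rewrite sqrtr_gt0.
have r2 : r ^+ 2 = t ^+ 2 - 1 by rewrite sqr_sqrtr// ltW.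
have cc : edot c c = t ^+ 2 by rewrite cE edotZl edotZr ee -/t; ring.
have xc x : unit_ball R n x -> x != c.
  apply: contraPneq => -> /=; rewrite /unit_ball/= enorm_lt1 cc; lra.
exists (fun x => c + (r ^+ 2 / enorm (x - c) ^+ 2) *: (x - c)).
apply: involution_punctured_ball_mobius (mobius_inversion c r0) _ _ _.
- exact: inversionK.
- rewrite /= (negbTE (xc 0 unit_ball0)) sub0r enormN sqr_enorm cc; congr Some.
  rewrite cE scalerN scalerA -scaleNr -scalerDl [RHS]ae; congr (_ *: e).
  by rewrite r2 /t; field; rewrite ?a_neq0.
move=> x xB; split; first by rewrite /= (negbTE (xc x xB)).
have d0 : 0 < edot (x - c) (x - c) by rewrite edot_gt0 subr_eq0 xc.
move: xB; rewrite /unit_ball/= !enorm_lt1 => xB.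
rewrite sqr_enorm; set d := edot (x - c) (x - c) in d0 *.
have dE : d = edot x x - 2 * edot x c + t ^+ 2.
  by rewrite /d !edotE [edot c x]edotC cc; ring.
rewrite -subr_gt0.
have -> : 1 - edot (c + (r ^+ 2 / d) *: (x - c)) (c + (r ^+ 2 / d) *: (x - c)) =
    r ^+ 2 / d * (1 - edot x x).
  rewrite !(edotDl c) !(edotDr c) !(edotZl (r ^+ 2 / d)) !(edotZr (r ^+ 2 / d)).
  rewrite -/d [edot (x - c) c]edotC cc.
  have -> : edot c (x - c) = (edot x x - d - t ^+ 2) / 2.
    by rewrite dE !edotE [edot c x]edotC cc; field.
  by rewrite r2; field; rewrite gt_eqF.
by rewrite mulr_gt0 ?divr_gt0 ?exprn_gt0// subr_gt0.
Qed.

End PuncturedBallMobius.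

Theorem theorem3p1 (R : realType) (n : nat) (hn : (2 <= n)%N)
    (a : 'rV[R]_n) (ha : unit_ball R n a) :
  [/\ (forall f : 'rV[R]_n -> 'rV[R]_n, punctured_ball_mobius a f ->
        forall x y : 'rV[R]_n,
          (unit_ball R n `\ 0) x -> (unit_ball R n `\ 0) y ->
          (1 - enorm a) / (1 + enorm a) * cassinian (unit_ball R n `\ 0) x y
            <= cassinian (unit_ball R n `\ a) (f x) (f y) /\
          cassinian (unit_ball R n `\ a) (f x) (f y)
            <= (1 + enorm a) / (1 - enorm a)
               * cassinian (unit_ball R n `\ 0) x y),
      (exists f : 'rV[R]_n -> 'rV[R]_n, punctured_ball_mobius a f /\
        exists x y : 'rV[R]_n,
          [/\ (unit_ball R n `\ 0) x, (unit_ball R n `\ 0) y, x <> y &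
          (1 - enorm a) / (1 + enorm a) * cassinian (unit_ball R n `\ 0) x y
            = cassinian (unit_ball R n `\ a) (f x) (f y)]) &
      (exists f : 'rV[R]_n -> 'rV[R]_n, punctured_ball_mobius a f /\
        exists x y : 'rV[R]_n,
          [/\ (unit_ball R n `\ 0) x, (unit_ball R n `\ 0) y, x <> y &
          cassinian (unit_ball R n `\ a) (f x) (f y)
            = (1 + enorm a) / (1 - enorm a)
              * cassinian (unit_ball R n `\ 0) x y])].
Proof.
have n_gt0 : (0 < n)%N := ltnW hn.
have [f fm] := exists_punctured_ball_mobius n_gt0 ha.
split.
- by move=> g gm x y xD yD; split; [exact: distortion_lower|exact: distortion_upper].
- by exists f; split=> //; exact: distortion_lower_attained.
- by exists f; split=> //; exact: distortion_upper_attained.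
Qed.
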